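(* Fix an integer $N$, non-constant polynomials $f_1(t),\ldots,f_n(t)\in\mathbb{Z}[t]$ with positive leading coefficients, and rational functions $g_0(t),g_1(t),\ldots,g_n(t)\in\mathbb{Q}(t)$. Set \[ M=\min_{0\le i\le n}\{v_t(g_i(t))\}. \] Suppose all of the following conditions hold: \begin{enumerate} \item \[ v_t\!\left(g_0(t)-\Big(1-\frac{1}{t}\Big)\sum_{\substack{i:\ f_i(1)=0}}g_i(t) -\sum_{\substack{i:\ f_i(1)\geq 2}}\big(1-t^{f_i(1)-1}\big) \frac{B_{f_i(1)}}{f_i(1)}\,g_i(t)\,f_i(t)\right)\geq N. \] \item For every even non-positive integer $k\in\{f_1(1),\ldots,f_n(1)\}$ and every integer $m$ with $1\leq m\leq N-M$, \[ v_t\!\left(\sum_{\substack{i:\ f_i(1)= k}} g_i(t)f_i(t)^m\right)\geq N+1-m. \] \item For every even positive integer $k\in\{f_1(1),\ldots,f_n(1)\}$ and every integer $m$ with $2\leq m\leq N-M$, \[ v_t\!\left(\sum_{\substack{i:\ f_i(1)= k}} g_i(t)\big(f_i(t)^m-k^{m-1}f_i(t)\big)\right)\geq N+1-m. \] \end{enumerate} Then there exists $P$ such that for every prime $p>P$, \[ \sum_{i=1}^n g_i(p)B_{f_i(p)}\equiv g_0(p)\pmod{p^N}. \]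
   Context: The Bernoulli numbers $B_n\in\mathbb{Q}$ are defined by $\frac{x}{e^x-1}=\sum_{n\ge0}B_n\frac{x^n}{n!}$. For a prime $p$ and rational numbers $a,b$, the congruence $a\equiv b\pmod{p^N}$ means $v_p(a-b)\ge N$, where $v_p$ is the $p$-adic valuation (i.e. congruence modulo $p^N\mathbb{Z}_{(p)}$). $v_t$ denotes the $t$-adic valuation on $\mathbb{Q}(t)$, i.e. $v_t(t^e a(t)/b(t))=e$ for $a,b\in\mathbb{Q}[t]$ with $a(0)b(0)\ne0$, and $v_t(0)=+\infty$. Sums over an empty index set are $0$. For large primes $p$, the values $g_i(p)$ are defined (no pole at $p$). *)

(* Defs.v *)
From HB Require Import structures.
From mathcomp Require Import all_boot all_order all_algebra.
From mathcomp Require Import fraction.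
Set Implicit Arguments. Unset Strict Implicit. Unset Printing Implicit Defensive.
Import Order.TTheory GRing.Theory Num.Theory.
Local Open Scope ring_scope.

(* Bernoulli numbers B_n (convention x/(e^x-1), so B_1 = -1/2), via the
   recurrence  sum_{k=0}^{n} C(n+1,k) B_k = 0 (n >= 1), B_0 = 1, which is
   equivalent to the generating-function definition. *)
Fixpoint bern_aux (n : nat) : seq rat :=
  match n with
  | 0 => [:: 1]
  | n'.+1 =>
      let s := bern_aux n' in
      let b := - (n.+1%:R)^-1 * \sum_(k < n) ('C(n.+1, k))%:R * nth 0 s k in
      rcons s b
  end.
Definition bern (n : nat) : rat := nth 0 (bern_aux n) n.

(* Bernoulli number at an integer index (junk value 0 for negative indices;
   only used at indices that are eventually positive / non-negative). *)
Definition bernz (k : int) : rat := if (0 <= k) then bern `|k|%N else 0.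

Notation ratfun := {fraction {poly rat}}.
Definition tvar : ratfun := tofrac 'X.
Definition ratfun_of_intpoly (f : {poly int}) : ratfun :=
  tofrac (map_poly (fun z : int => z%:~R : rat) f).

Definition vt (x : ratfun) : int :=
  let r := repr x in (mup 0 (frac r).1)%:Z - (mup 0 (frac r).2)%:Z.
(* t-adic valuation with values in int ∪ {+oo} (None = +oo, for x = 0). *)
Definition vt_opt (x : ratfun) : option int := if x == 0 then None else Some (vt x).
Definition vt_ge (x : ratfun) (K : int) : bool :=
  if vt_opt x is Some v then K <= v else true.

Definition ominz (a b : option int) : option int :=
  match a, b with
  | Some x, Some y => Some (Num.min x y)
  | None, _ => b
  | _, None => a
  end.
(* m <= N - M, with N - (+oo) = -oo *)
Definition le_N_minus (m N : int) (M : option int) : bool :=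
  if M is Some M' then m <= N - M' else false.

Definition feval (x : ratfun) (p : int) : rat :=
  let r := repr x in (frac r).1.[p%:~R] / (frac r).2.[p%:~R].

Definition vp (p : nat) (q : rat) : int :=
  (logn p `|numq q|%N)%:Z - (logn p `|denq q|%N)%:Z.
Definition congr_pN (p : nat) (N : int) (a b : rat) : bool :=
  (a - b == 0) || (N <= vp p (a - b)).

Definition ratc (q : rat) : ratfun := tofrac (q%:P).

(* Main.v *)
Require Import Defs.
From HB Require Import structures.
From mathcomp Require Import all_boot all_order all_algebra.
From mathcomp Require Import fraction cyclic ring lra zify.
Import Order.TTheory GRing.Theory Num.Theory.
Local Open Scope ring_scope.

(* Write [x^n], for a p-adic unit [x], as the [n]-th power of its Teichmueller part, which depends
   on [n] modulo [p - 1] only, times the [n]-th power of a principal unit, which has a binomial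
   expansion in [n]. The multiplication theorem
     (1 - p^(n-1)) B_n = 1/p * sum_i C(n, i) p^i B_i * sum_(0 < a < p) a^(n-i)
   then shows that on a residue class of [n] modulo [p - 1] the left-hand side is, modulo [p^L], a
   polynomial in [n] whose coefficient of [n^m] is divisible by [p^(m-1)]; its constant
   coefficient is the average [1/p * sum_a omega(a)^n], i.e. [1 - 1/p] on the class of 0 and 0 on
   the others. As [f_i(p) = f_i(1)] modulo [p - 1], grouping the indices by [k = f_i(1)] and
   comparing coefficients of [f_i(p)^m] yields the second condition; for [k > 0] the polynomial
   is moreover known at [n = k], which eliminates its linear coefficient and yields the third
   condition and the Bernoulli numbers in the first one. *)

(** * Valuations *)

(* The p-adic valuation of [q] is at least [K]; this holds for [q = 0]. *)
Definition vge (p : nat) (K : int) (q : rat) : Prop :=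
  exists a : int, exists2 d : nat, coprime p d & q * d%:R = p%:R ^ K * a%:~R.

Lemma prime_natr_neq0 (p : nat) : prime p -> p%:R != 0 :> rat.
Proof. by move=> pr; rewrite pnatr_eq0 -lt0n prime_gt0. Qed.

Lemma coprime_natr_neq0 (p d : nat) : prime p -> coprime p d -> d%:R != 0 :> rat.
Proof.
move=> pr; rewrite pnatr_eq0; case: d => // /eqP; rewrite gcdn0 => p1.
by rewrite p1 in pr.
Qed.

Lemma vge0 p K : vge p K 0.
Proof. by exists 0, 1%N; rewrite ?coprimen1 // mul0r mulr0. Qed.

Lemma vge_int p (z : int) : vge p 0 z%:~R.
Proof. by exists z, 1%N; rewrite ?coprimen1 // mulr1 expr0z mul1r. Qed.

Lemma vge_nat p (n : nat) : vge p 0 n%:R.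
Proof. exact: (vge_int p n). Qed.

Lemma vge_expz p K : vge p K (p%:R ^ K).
Proof. by exists 1, 1%N; rewrite ?coprimen1. Qed.

Lemma vge_natV p d : prime p -> coprime p d -> vge p 0 (d%:R^-1).
Proof.
by move=> pr cpd; exists 1, d => //; rewrite mulVf ?(coprime_natr_neq0 _ _ pr cpd).
Qed.

Lemma vgeM p K K' x y : prime p -> vge p K x -> vge p K' y -> vge p (K + K') (x * y).
Proof.
move=> pr [a [d cd ha]] [b [e ce hb]]; exists (a * b), (d * e)%N.
  by rewrite coprimeMr cd ce.
by rewrite natrM mulrACA ha hb rmorphM /= exprzDr ?unitfE ?prime_natr_neq0 // mulrACA.
Qed.

Lemma vge_le p K K' x : prime p -> K' <= K -> vge p K x -> vge p K' x.
Proof.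
move=> pr le [a [d cd ha]]; have eK : K = K' + `|K - K'|%:Z by lia.
exists ((p ^ `|K - K'|)%N%:Z * a), d => //.
rewrite {1}eK exprzDr ?unitfE ?prime_natr_neq0 // in ha.
by rewrite ha rmorphM /= -pmulrn natrX mulrA.
Qed.

Lemma vgeD p K x y : prime p -> vge p K x -> vge p K y -> vge p K (x + y).
Proof.
move=> pr [a [d cd ha]] [b [e ce hb]]; exists (a * e%:Z + b * d%:Z), (d * e)%N.
  by rewrite coprimeMr cd ce.
rewrite natrM rmorphD !rmorphM /= -!pmulrn mulrDr !mulrA -ha -hb; ring.
Qed.

Lemma vgeN p K x : vge p K x -> vge p K (- x).
Proof.
by move=> [a [d cd ha]]; exists (- a), d => //; rewrite rmorphN mulrN mulNr ha.
Qed.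

Lemma vgeB p K x y : prime p -> vge p K x -> vge p K y -> vge p K (x - y).
Proof. by move=> pr hx hy; apply: vgeD => //; apply: vgeN. Qed.

Lemma vge_sum p K (I : Type) (r : seq I) (P : pred I) (F : I -> rat) :
  prime p -> (forall i, P i -> vge p K (F i)) -> vge p K (\sum_(i <- r | P i) F i).
Proof.
move=> pr h; apply: (big_ind (vge p K)) => //; first exact: vge0.
by move=> x y; apply: vgeD.
Qed.

Lemma vgeMl p K x y : prime p -> vge p 0 x -> vge p K y -> vge p K (x * y).
Proof. by move=> pr hx hy; rewrite -[K]add0r; apply: vgeM. Qed.

Lemma vgeMr p K x y : prime p -> vge p K x -> vge p 0 y -> vge p K (x * y).
Proof. by move=> pr hx hy; rewrite mulrC; apply: vgeMl. Qed.

Lemma vge_exp p (x : rat) (K n : nat) : prime p -> vge p K%:Z x -> vge p (K * n)%N%:Z (x ^+ n).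
Proof.
move=> pr hx; elim: n => [|n IH]; first by rewrite muln0; apply: (vge_nat p 1).
by rewrite exprS mulnS PoszD; apply: vgeM.
Qed.

Lemma vge_exp0 p (x : rat) (n : nat) : prime p -> vge p 0 x -> vge p 0 (x ^+ n).
Proof. by move=> pr hx; have := vge_exp p x 0 n pr hx; rewrite mul0n. Qed.

Lemma vge_modn p e (a b : nat) : a = b %[mod p ^ e] -> vge p e%:Z (a%:R - b%:R).
Proof.
move=> h; exists ((a %/ p ^ e)%N%:Z - (b %/ p ^ e)%N%:Z), 1%N; first exact: coprimen1.
rewrite mulr1 {1}(divn_eq a (p ^ e)) {1}(divn_eq b (p ^ e)) h.
by rewrite rmorphB /= -!pmulrn !natrD !natrM !natrX -exprnP; ring.
Qed.

Lemma vge_congr_pN p N a b : prime p -> vge p N (a - b) -> congr_pN p N a b.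
Proof.
rewrite /congr_pN /vp => pr [z [d cd]]; set q := a - b.
have [->//|q0 /=] := eqVneq q 0; move=> h.
have d0 : (0 < d)%N by have := coprime_natr_neq0 _ _ pr cd; rewrite pnatr_eq0 lt0n.
(* Writing [N] as a difference of naturals, one of them 0, turns the equation into one between
   natural numbers, to which [logn] applies. *)
pose e1 := if 0 <= N then `|N|%N else 0%N; pose e2 := if 0 <= N then 0%N else `|N|%N.
have hN : N = e1%:Z - e2%:Z by rewrite /e1 /e2; case: ifP; lia.
have key : (p ^ e2 * `|numq q| * d = p ^ e1 * `|z| * `|denq q|)%N.
  suff : (p ^ e2)%N%:Z * numq q * d%:Z = (p ^ e1)%N%:Z * z * denq q.
    by move/(congr1 absz); rewrite !abszM.
  apply/(@intr_inj rat); rewrite !rmorphM /= -!pmulrn numqE !natrX.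
  have -> : p%:R ^+ e1 = p%:R ^+ e2 * p%:R ^ N :> rat.
    by rewrite !exprnP -exprzDr ?unitfE ?prime_natr_neq0 // hN subrKC.
  by rewrite -!mulrA [_%:~R * d%:R]mulrC !mulrA -[_ * _ * d%:R]mulrA h; ring.
have num0 : (0 < `|numq q|)%N by rewrite absz_gt0 numq_eq0.
have den0 : (0 < `|denq q|)%N by rewrite absz_gt0 denq_neq0.
have pp m : (0 < p ^ m)%N by rewrite expn_gt0 prime_gt0.
have z0 : (0 < `|z|)%N.
  have : (0 < p ^ e2 * `|numq q| * d)%N by rewrite !muln_gt0 pp num0 d0.
  by rewrite key !muln_gt0 => /andP[/andP[]].
move/(congr1 (logn p)): key.
rewrite !lognM ?muln_gt0 ?pp // !pfactorK // (@logn_coprime p d) // hN; lia.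
Qed.

(** * Bernoulli numbers *)

Lemma size_bern_aux n : size (bern_aux n) = n.+1.
Proof. by elim: n => [|n IH] //=; rewrite size_rcons IH. Qed.

Lemma nth_bern_aux n k : (k <= n)%N -> nth 0 (bern_aux n) k = bern k.
Proof.
elim: n => [|n IH] kn; first by have -> : k = 0%N by lia.
have [->//|lt] := eqVneq k n.+1.
have ltk : (k < n.+1)%N by lia.
by rewrite /= nth_rcons size_bern_aux ltk IH.
Qed.

Lemma bern0 : bern 0 = 1. Proof. by []. Qed.

Lemma bernS n :
  bern n.+1 = - (n.+2%:R)^-1 * \sum_(k < n.+1) 'C(n.+2, k)%:R * bern k.
Proof.
rewrite /bern /= nth_rcons size_bern_aux ltnn eqxx; congr (_ * _).
by apply: eq_bigr => k _; rewrite nth_bern_aux // -ltnS ltn_ord.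
Qed.

Lemma bern_sum n : \sum_(k < n.+1) 'C(n.+1, k)%:R * bern k = (n == 0)%:R.
Proof.
case: n => [|n]; first by rewrite big_ord1 /= bin0 mul1r bern0.
rewrite big_ord_recr /= bernS binSn mulNr mulrN mulVKf ?subrr //.
by rewrite pnatr_eq0.
Qed.

(** The coefficient of [b n] in the [n]-th equation is n + 1, so the recurrence determines the
    sequence; a candidate is identified with the Bernoulli numbers by checking it. *)
Lemma bern_unique (b : nat -> rat) :
  (forall n, \sum_(k < n.+1) 'C(n.+1, k)%:R * b k = (n == 0)%:R) ->
  forall n, b n = bern n.
Proof.
move=> hb; elim/ltn_ind => n IH.
have := hb n; rewrite -bern_sum !big_ord_recr /=.
rewrite (eq_bigr (fun k : 'I_n => 'C(n.+1, k)%:R * bern k)) => [/addrI|k _]; last by rewrite IH.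
by apply: mulfI; rewrite binSn pnatr_eq0.
Qed.

(* The umbral functional 'X^n |-> B_n. *)
Definition umbral (q : {poly rat}) : rat := \sum_(i < size q) q`_i * bern i.

Lemma umbralE m (q : {poly rat}) :
  (size q <= m)%N -> umbral q = \sum_(i < m) q`_i * bern i.
Proof.
move=> sq; rewrite /umbral (big_ord_widen _ (fun i => q`_i * bern i) sq).
rewrite big_mkcond; apply: eq_bigr => i _; case: ltnP => // le.
by rewrite nth_default ?mul0r.
Qed.

Lemma umbral_is_scalar : scalar umbral.
Proof.
move=> a p q; pose m := maxn (size (a *: p + q)) (maxn (size p) (size q)).
rewrite !(@umbralE m) ?leq_max ?leqnn ?orbT // mulr_sumr -big_split.
by apply: eq_bigr => i _; rewrite coefD coefZ mulrDl mulrA.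
Qed.
HB.instance Definition _ := GRing.isLinear.Build rat {poly rat} rat *%R umbral umbral_is_scalar.

Lemma umbralXn n : umbral 'X^n = bern n.
Proof.
rewrite /umbral size_polyXn big_ord_recr /= coefXn eqxx mul1r big1 ?add0r // => i _.
by rewrite coefXn ltn_eqF ?mul0r.
Qed.

Lemma umbral_binom (a b : rat) n : umbral ((a *: 'X + b%:P) ^+ n)
  = \sum_(i < n.+1) 'C(n, i)%:R * a ^+ i * bern i * b ^+ (n - i).
Proof.
rewrite addrC exprDn linear_sum; apply: eq_bigr => i _ /=.
rewrite -rmorphXn /= mul_polyC exprZn scalerA -scaler_nat scalerA linearZ /= umbralXn; ring.
Qed.

(** The umbral form of the recurrence, that is, the value B_n(1) of the Bernoulli polynomial. *)
Lemma umbral_shift n : umbral (('X + 1) ^+ n) = bern n + (n == 1)%:R.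
Proof.
have := umbral_binom 1 1 n; rewrite scale1r => ->.
rewrite big_ord_recr /= binn !expr1n !mul1r mulr1 addrC; congr (_ + _).
case: n => [|n]; first by rewrite big_ord0.
by rewrite eqSS -bern_sum; apply: eq_bigr => i _; rewrite !expr1n !mulr1.
Qed.

(** Under the umbral functional, the sum in the Bernoulli recurrence becomes a difference of two
    powers. *)
Lemma sum_binom_expr (R : comNzRingType) (x : R) n :
  \sum_(k < n.+1) x ^+ k *+ 'C(n.+1, k) = (x + 1) ^+ n.+1 - x ^+ n.+1.
Proof.
rewrite [x + 1]addrC exprDn [in RHS]big_ord_recr /= binn subnn expr0 mul1r mulr1n addrK.
by apply: eq_bigr => i _; rewrite expr1n mul1r.
Qed.

(* The multiplication theorem for Bernoulli polynomials at 0. *)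
Lemma bern_mult (p n : nat) : (0 < p)%N ->
  p%:R * bern n =
  \sum_(i < n.+1) 'C(n, i)%:R * p%:R ^+ i * bern i * \sum_(a < p) a%:R ^+ (n - i).
Proof.
move=> p0; have pn0 : p%:R != 0 :> rat by rewrite pnatr_eq0 -lt0n.
pose t (a : nat) : {poly rat} := p%:R *: 'X + a%:R%:P.
(* In terms of Bernoulli polynomials, [b m] is p^(m-1) times the sum of the B_m(a/p); it satisfies
   the recurrence of the Bernoulli numbers. *)
pose b m := p%:R^-1 * umbral (\sum_(a < p) t a ^+ m).
have hb m : b m = bern m.
  apply: bern_unique => {}m.
  have -> : \sum_(k < m.+1) 'C(m.+1, k)%:R * b k =
    p%:R^-1 * umbral (\sum_(a < p) \sum_(k < m.+1) t a ^+ k *+ 'C(m.+1, k)).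
    rewrite exchange_big /= [umbral _]linear_sum mulr_sumr; apply: eq_bigr => k _ /=.
    by rewrite sumrMnl raddfMn /= -mulr_natl /b; ring.
  have -> : \sum_(a < p) \sum_(k < m.+1) t a ^+ k *+ 'C(m.+1, k)
      = p%:R ^+ m.+1 *: (('X + 1) ^+ m.+1 - 'X ^+ m.+1).
    under eq_bigr => a _ do rewrite sum_binom_expr.
    (* Since [t a + 1] is [t a.+1], the sum telescopes, from [p X] to [p (X + 1)]. *)
    have -> : \sum_(a < p) ((t a + 1) ^+ m.+1 - t a ^+ m.+1) = t p ^+ m.+1 - t 0%N ^+ m.+1.
      rewrite -[RHS](telescope_sumr (fun a => t a ^+ m.+1)) // big_mkord; apply: eq_bigr => a _.
      by congr (_ ^+ _ - _); rewrite /t -addrA -natr1 polyCD.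
    by rewrite /t addr0 scalerBr -!exprZn scalerDr alg_polyC.
  rewrite linearZ linearB /= umbral_shift umbralXn addrAC subrr add0r eqSS.
  by case: m => [|m]; rewrite ?mulr1 ?mulr0 // expr1 mulVf.
rewrite -hb /b mulVKf // linear_sum /=.
under eq_bigr => a _ do rewrite umbral_binom.
by rewrite exchange_big; apply: eq_bigr => i _; rewrite mulr_sumr.
Qed.

(* The reflection [X |-> - (X + 1)] preserves the umbral functional. *)
Lemma bern_odd n : odd n -> (1 < n)%N -> bern n = 0.
Proof.
move=> on n1; pose b m := umbral ((- ('X + 1)) ^+ m).
have hb m : b m = bern m.
  apply: bern_unique => {}m.
  have -> : \sum_(k < m.+1) 'C(m.+1, k)%:R * b k =
    umbral (\sum_(k < m.+1) (- ('X + 1)) ^+ k *+ 'C(m.+1, k)).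
    by rewrite linear_sum; apply: eq_bigr => k _ /=; rewrite raddfMn mulr_natl.
  rewrite sum_binom_expr; have -> : - ('X + 1) + 1 = - 'X :> {poly rat} by ring.
  have sc q : (- q) ^+ m.+1 = (-1) ^+ m.+1 *: q ^+ m.+1 :> {poly rat}.
    by rewrite -scaleN1r exprZn.
  rewrite !sc -scalerBr linearZ linearB /= umbral_shift umbralXn eqSS.
  by case: m {sc} => [|m] /=; rewrite ?eqxx; ring.
(* For odd [n > 1] the umbral images of the two sides are - B_n and B_n. *)
have : (-1) ^+ n *: ('X + 1) ^+ n = (- ('X + 1)) ^+ n :> {poly rat}.
  by rewrite -exprZn scaleN1r.
move/(congr1 umbral); rewrite linearZ /= umbral_shift -[umbral (_ ^+ n)]/(b n) hb.
by rewrite -signr_odd on gtn_eqF // addr0; lra.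
Qed.

(** * Denominators of Bernoulli numbers *)

Lemma vge_primeV p : vge p (- 1) (p%:R^-1).
Proof. by have := vge_expz p (- 1); rewrite -invr_expz expr1z. Qed.

Lemma vge_primeX p n : vge p n%:Z (p%:R ^+ n).
Proof. by rewrite exprnP; apply: vge_expz. Qed.

Definition unit_powersum (p m : nat) : rat := \sum_(1 <= a < p) a%:R ^+ m.

Lemma vge_unit_powersum p m : prime p -> vge p 0 (unit_powersum p m).
Proof. by move=> pr; apply: vge_sum => // a _; rewrite -natrX; apply: vge_nat. Qed.

(** In [bern_mult] the summand a = 0 survives for [i = n] only, where it is p^n B_n; removing it
    leaves the a prime to p and puts the factor p - p^n on the left. *)
Lemma bern_mult_unit (p n : nat) : (0 < p)%N ->
  p%:R * bern n - p%:R ^+ n * bern n =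
  \sum_(i < n.+1) 'C(n, i)%:R * p%:R ^+ i * bern i * unit_powersum p (n - i).
Proof.
move=> p0; have -> : p%:R ^+ n * bern n =
    \sum_(i < n.+1) 'C(n, i)%:R * p%:R ^+ i * bern i * 0 ^+ (n - i).
  rewrite big_ord_recr /= subnn binn expr0 mul1r mulr1 big1 ?add0r // => i _.
  by rewrite expr0n subn_eq0 leqNgt ltn_ord mulr0.
rewrite bern_mult // -sumrB; apply: eq_bigr => i _.
by rewrite -mulrBr -(big_mkord xpredT (fun a => a%:R ^+ (n - i))) big_ltn // addrC addKr.
Qed.

Lemma vge_subr_pX_V p m : prime p -> (0 < m)%N -> vge p 0 ((1 - p%:R ^+ m)^-1).
Proof.
move=> pr m0; have pm0 : (0 < p ^ m)%N by rewrite expn_gt0 prime_gt0.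
have -> : 1 - p%:R ^+ m = - ((p ^ m).-1)%:R :> rat.
  by rewrite -natrX -[in X in 1 - X](prednK pm0) -natr1; ring.
rewrite invrN; apply/vgeN/vge_natV => //.
by rewrite -(coprime_pexpl _ _ m0) coprimenP.
Qed.

(* The weak half of von Staudt-Clausen. *)
Lemma vge_bern p n : prime p -> vge p (- 1) (bern n).
Proof.
move=> pr; have p0 := prime_natr_neq0 _ pr; elim/ltn_ind: n => -[_|n IH].
  by apply: (@vge_le _ 0) => //; rewrite bern0; apply: (vge_nat p 1).
have := bern_mult_unit p n.+1 (prime_gt0 pr).
rewrite big_ord_recr /= binn subnn mul1r /unit_powersum.
under [in X in _ = _ + X]eq_bigr => a _ do rewrite expr0.
rewrite sumr_const_nat -mulr_natl mulr1 natrB ?prime_gt0 //.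
set S := \sum_(i < n.+1) _ => h.
(* The term [i = n.+1] contains [bern n.+1] too; moving it to the left gives p (1 - p^(n+1)) B_(n+1)
   = S. By induction p^i B_i is p-integral for the remaining i, hence so is S. *)
have -> : bern n.+1 = p%:R^-1 * (S * (1 - p%:R ^+ n.+1)^-1).
  have u0 : 1 - p%:R ^+ n.+1 != 0 :> rat.
    rewrite subr_eq0 eq_sym -natrX pnatr_eq1 gtn_eqF //.
    by rewrite -[1%N](exp1n n.+1) ltn_exp2r ?prime_gt1.
  apply: (mulfI p0); rewrite mulVKf //; apply: (mulIf u0); rewrite divfK //.
  by rewrite -[S](addrK (p%:R ^+ n.+1 * bern n.+1 * (p%:R - 1))) -h; ring.
apply: (@vgeMr _ (-1)) => //; first exact: vge_primeV.
apply: vgeMl => //; last exact: vge_subr_pX_V.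
apply: vge_sum => // -[[|i] ip] _ /=.
  rewrite bin0 expr0 bern0 !mul1r; exact: vge_unit_powersum.
apply: vgeMl => //; last exact: vge_unit_powersum.
rewrite -mulrA; apply: vgeMl => //; first exact: vge_nat.
  apply: (@vge_le _ (i.+1%:Z + -1)) => //.
by apply: vgeM => //; [exact: vge_primeX|exact: IH].
Qed.

(** All denominators met in the recurrence up to this index are below p. *)
Lemma vge_bern_small p n : prime p -> (n.+1 < p)%N -> vge p 0 (bern n).
Proof.
move=> pr; elim/ltn_ind: n => -[_ _|n IH np]; first by rewrite bern0; apply: (vge_nat p 1).
rewrite bernS mulNr; apply/vgeN/vgeMl => //.
  by apply: vge_natV => //; rewrite prime_coprime // gtnNdvd.
apply: vge_sum => // i _; apply: vgeMl => //; first exact: vge_nat.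
by apply: IH => //; have := ltn_ord i; lia.
Qed.

(** * Interpolation of Bernoulli numbers on a residue class modulo p - 1 *)

Lemma vge_subX p e x y m : prime p -> vge p 0 x -> vge p 0 y ->
  vge p e (x - y) -> vge p e (x ^+ m - y ^+ m).
Proof.
move=> pr hx hy h; rewrite subrXX; apply: vgeMr => //; apply: vge_sum => // i _.
by apply: vgeMl => //; apply: vge_exp0.
Qed.

(** The cofactor of x - y in x^p - y^p is a sum of p terms, all congruent to y^(p-1) modulo p, so it
    supplies one more factor p. *)
Lemma vge_subXp p (e : nat) x y : prime p -> vge p 0 x -> vge p 0 y -> (0 < e)%N ->
  vge p e%:Z (x - y) -> vge p e.+1%:Z (x ^+ p - y ^+ p).
Proof.
move=> pr hx hy e0 h; rewrite subrXX -addn1 PoszD; apply: vgeM => //.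
have -> : \sum_(i < p) x ^+ (p.-1 - i) * y ^+ i =
   \sum_(i < p) (x ^+ (p.-1 - i) - y ^+ (p.-1 - i)) * y ^+ i + p%:R * y ^+ p.-1.
  rewrite -[p in p%:R * _]card_ord mulr_natl -sumr_const -big_split; apply: eq_bigr => i _ /=.
  have hi : (p.-1 = (p.-1 - i) + i)%N by have := ltn_ord i; lia.
  by rewrite [in X in _ = _ + X]hi exprD; ring.
apply: vgeD => //.
  apply: vge_sum => // i _; apply: vgeMr => //; last exact: vge_exp0.
  by apply: vge_subX => //; apply: vge_le h => //; lia.
by apply: vgeMr => //; [exact: (vge_primeX p 1)|exact: vge_exp0].
Qed.

Lemma vge_subXpn p (x y : rat) L : prime p -> vge p 0 x -> vge p 0 y ->
  vge p 1 (x - y) -> vge p L.+1%:Z (x ^+ (p ^ L) - y ^+ (p ^ L)).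
Proof.
move=> pr hx hy h; elim: L => [|L IH]; first by rewrite !expr1.
by rewrite expnSr !exprM; apply: vge_subXp => //; apply: vge_exp0.
Qed.

Lemma expn_congr x m q n k :
  x ^ m = 1 %[mod q] -> n = k %[mod m] -> x ^ n = x ^ k %[mod q].
Proof.
move=> h e; have red r : x ^ r = x ^ (r %% m) %[mod q].
  have -> : (x ^ r = (x ^ m) ^ (r %/ m) * x ^ (r %% m))%N.
    by rewrite -expnM -expnD mulnC -divn_eq.
  by rewrite -modnMml -modnXm h modnXm exp1n modnMml mul1n.
by rewrite (red n) (red k) e.
Qed.

Lemma coprime_fact p i : prime p -> (i < p)%N -> coprime p i`!.
Proof.
move=> pr; elim: i => [|i IH] ip; first by rewrite coprimen1.
by rewrite factS coprimeMr IH ?(ltnW ip) // prime_coprime // gtnNdvd.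
Qed.

(** The binomial coefficient as a polynomial in its upper argument. *)
Definition binp (i : nat) : {poly rat} := (i`!%:R)^-1 *: \prod_(t < i) ('X - t%:R%:P).

Lemma horner_binp i (n : nat) : (binp i).[n%:R] = 'C(n, i)%:R.
Proof.
rewrite /binp hornerZ horner_prod.
have -> : \prod_(t < i) ('X - t%:R%:P).[n%:R] = (n ^_ i)%:R :> rat.
  elim: i => [|i IH]; first by rewrite big_ord0.
  rewrite big_ord_recr /= IH ffactnSr natrM !hornerE.
  by case: (leqP i n) => [le|lt]; [rewrite natrB|rewrite ffact_small // !mul0r].
by rewrite -bin_ffact natrM mulrC mulfK // pnatr_eq0 -lt0n fact_gt0.
Qed.

Lemma size_binp i : (size (binp i) <= i.+1)%N.
Proof.
apply: leq_trans (size_scale_leq _ _) _; elim: i => [|i IH].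
  by rewrite big_ord0 size_poly1.
by rewrite big_ord_recr /= (leq_trans (size_polyMleq _ _)) // size_XsubC addn2.
Qed.

Definition pvge p (q : {poly rat}) := forall m, vge p 0 q`_m.

Lemma pvgeM p q r : prime p -> pvge p q -> pvge p r -> pvge p (q * r).
Proof. by move=> pr hq hr m; rewrite coefM; apply: vge_sum => // i _; apply: vgeMl. Qed.

(** The only denominator is i!, a p-adic unit for i < p. *)
Lemma pvge_binp p i : prime p -> (i < p)%N -> pvge p (binp i).
Proof.
move=> pr ip m; rewrite coefZ; apply: vgeMl => //.
  by apply: vge_natV => //; apply: coprime_fact.
move: m; apply: (big_ind (pvge p)) => [m|q r hq hr|t _ m]; last 1 first.
- rewrite coefB coefX coefC; apply: vgeB => //; first exact: vge_nat.
  by case: ifP => _; [exact: vge_nat|exact: vge0].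
- by rewrite coef1; apply: vge_nat.
- exact: pvgeM.
Qed.

(** Two truncations of a series are compared by extending both to a common length, whichever of them
    is longer. *)
Lemma vge_sum_tail p K (F : nat -> rat) m m' : prime p -> (m <= m')%N ->
  (forall i, (m <= i)%N -> vge p K (F i)) ->
  vge p K (\sum_(i < m') F i - \sum_(i < m) F i).
Proof.
move=> pr le h; rewrite -!(big_mkord xpredT F) (big_cat_nat (leq0n m) le) /= addrAC subrr add0r.
by rewrite big_nat_cond; apply: vge_sum => // i /andP[/andP[mi _] _]; apply: h.
Qed.

(* [teich p L a] is congruent to the Teichmueller representative of [a] modulo [p ^ L.+1]. *)
Definition teich (p L a : nat) : nat := (a ^ (p ^ L))%N.

(* [a] divided by its Teichmueller representative, the order of which divides [p - 1]. *)
Definition principal_part (p L a : nat) : nat := (a * teich p L a ^ (p - 2))%N.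

(** An inverse of [a] modulo [p ^ L.+1] by Euler's theorem, when p does not divide [a]; being a
    natural number, it allows congruences in [nat]. *)
Definition inv_mod (p L a : nat) : nat := (a ^ (totient (p ^ L.+1)).-1)%N.

Lemma coprime_lt (p a : nat) : prime p -> (0 < a)%N -> (a < p)%N -> coprime p a.
Proof. by move=> pr a0 ap; rewrite prime_coprime // gtnNdvd. Qed.

Lemma totient_pX_gt0 p L : prime p -> (0 < totient (p ^ L.+1))%N.
Proof. by move=> pr; rewrite totient_gt0 expn_gt0 prime_gt0. Qed.

Lemma teich_order p L a : prime p -> (0 < a)%N -> (a < p)%N ->
  teich p L a ^ p.-1 = 1 %[mod p ^ L.+1].
Proof.
move=> pr a0 ap; rewrite /teich -expnM mulnC.
have := totient_pfactor pr (ltn0Sn L); rewrite /= => <-.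
by apply: Euler_exp_totient; rewrite coprime_sym coprimeXl // coprime_lt.
Qed.

Lemma vge_teich_sub p L a : prime p -> (0 < a)%N -> (a < p)%N ->
  vge p 1 ((teich p L a)%:R - a%:R).
Proof.
move=> pr a0 ap; apply: (@vge_modn _ 1); rewrite expn1 /teich.
elim: L => [|L IH]; first by rewrite expn0 expn1.
rewrite expnSr expnM -modnXm IH modnXm -{1}(prednK (prime_gt0 pr)) expnS.
rewrite -modnMmr -(totient_prime pr) Euler_exp_totient ?modnMmr ?muln1 //.
by rewrite coprime_sym coprime_lt.
Qed.

(** Modulo p, [teich p L a] is [a], so the principal part is a^(p-1), that is 1 by Fermat's
    theorem. *)
Lemma vge_principal_part p L a : prime p -> (2 < p)%N -> (0 < a)%N -> (a < p)%N ->
  vge p 1 ((principal_part p L a)%:R - 1).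
Proof.
move=> pr p2 a0 ap; rewrite /principal_part natrM natrX.
have -> : a%:R * (teich p L a)%:R ^+ (p - 2) - 1 =
   a%:R * ((teich p L a)%:R ^+ (p - 2) - a%:R ^+ (p - 2)) + (a%:R ^+ p.-1 - 1) :> rat.
  have -> : p.-1 = (p - 2).+1 by lia.
  by rewrite exprS; ring.
apply: vgeD => //.
  apply: vgeMl => //; first exact: vge_nat.
  by apply: vge_subX; rewrite ?vge_teich_sub //; [exact: vge_nat|exact: vge_nat|exact: vge_teich_sub].
rewrite -natrX; apply: (@vge_modn _ 1 _ 1); rewrite expn1 -(totient_prime pr).
by rewrite Euler_exp_totient // coprime_sym coprime_lt.
Qed.

(** Separates [n] from [i] in the exponent, leaving a^n as the only factor that depends on [n]. *)
Lemma vge_inv_mod p L a i n : prime p -> (0 < a)%N -> (a < p)%N -> (i <= n)%N ->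
  vge p L.+1%:Z (a%:R ^+ (n - i) - a%:R ^+ n * (inv_mod p L a)%:R ^+ i).
Proof.
move=> pr a0 ap le; rewrite -!natrX -natrM; apply: vge_modn.
rewrite /inv_mod -{2}(subnK le) expnD -mulnA -expnMn -expnS prednK ?totient_pX_gt0 //.
rewrite -modnMmr -[((a ^ totient _) ^ i %% _)%N]modnXm Euler_exp_totient;
  last by rewrite coprime_sym coprimeXl // coprime_lt.
by rewrite modnXm exp1n modnMmr muln1.
Qed.

(** Modulo [p ^ L.+1], [a] is [teich] times its principal part, because [teich ^ p.-1] is 1; for the
    same reason [teich ^ n] is [teich ^ k]. *)
Lemma vge_teich_exp p L a n k : prime p -> (2 < p)%N -> (0 < a)%N -> (a < p)%N ->
  n = k %[mod p.-1] ->
  vge p L.+1%:Z (a%:R ^+ n - (teich p L a)%:R ^+ k * (principal_part p L a)%:R ^+ n).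
Proof.
move=> pr p2 a0 ap nk; rewrite -!natrX -natrM; apply: vge_modn.
have ord := teich_order p L a pr a0 ap.
rewrite -modnMml -(expn_congr _ _ _ _ _ ord nk) modnMml /principal_part.
rewrite expnMn mulnCA -expnMn -expnS (_ : (p - 2).+1 = p.-1); last lia.
by rewrite -modnMmr -[((teich p L a ^ _) ^ n %% _)%N]modnXm ord modnXm exp1n modnMmr muln1.
Qed.

(* Newton's expansion of [(1 + u) ^ n] is cut off at order [L] because [p] divides [u]. *)
Lemma vge_newton p L (x : rat) n : prime p -> vge p 1 (x - 1) ->
  vge p L.+1%:Z (x ^+ n - \sum_(j < L.+1) 'C(n, j)%:R * (x - 1) ^+ j).
Proof.
move=> pr hx; pose F j : rat := 'C(n, j)%:R * (x - 1) ^+ j.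
have -> : x ^+ n = \sum_(j < n.+1) F j.
  rewrite -{1}[x](subrK 1) addrC exprDn; apply: eq_bigr => j _.
  by rewrite expr1n mul1r -mulr_natl.
have -> : \sum_(j < n.+1) F j - \sum_(j < L.+1) F j =
   (\sum_(j < n.+1 + L.+1) F j - \sum_(j < L.+1) F j)
   - (\sum_(j < n.+1 + L.+1) F j - \sum_(j < n.+1) F j) by ring.
apply: vgeB => //; apply: vge_sum_tail; rewrite ?leq_addl ?leq_addr // => j hj.
  apply: vgeMl => //; first exact: vge_nat.
  by apply: (@vge_le _ (1 * j)%N%:Z); [|lia|exact: vge_exp].
by rewrite /F bin_small // mul0r; apply: vge0.
Qed.

(** * The interpolating polynomial *)

(** The coefficient of C(n, i) C(n, j) when, in 1/p times [bern_mult_unit], a^(n-i) becomes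
    [teich ^ k], times [inv_mod ^ i], times the Newton series of [principal_part ^ n]. *)
Definition kummer_coef (p L k i j : nat) : rat :=
  p%:R^-1 * (p%:R ^+ i * bern i) *
  \sum_(1 <= a < p) (teich p L a)%:R ^+ k * (inv_mod p L a)%:R ^+ i
     * ((principal_part p L a)%:R - 1) ^+ j.

(* For [n = k %[mod p.-1]], this is [(1 - p ^ n.-1) * bern n] modulo [p ^ L]: in [bern_mult_unit],
   [a ^ (n - i)] is written as a power of the Teichmueller representative of [a], which
   depends on [k] only, times a Newton series in [n]. *)
Definition kummer_poly (p L k : nat) : {poly rat} :=
  \sum_(i < L.+1) \sum_(j < L.+1) kummer_coef p L k i j *: (binp i * binp j).

Lemma vge_pX_bern p i : prime p -> (i.+1 < p)%N -> vge p i%:Z (p%:R ^+ i * bern i).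
Proof.
by move=> pr ip; apply: vgeMr; [|exact: vge_primeX|exact: vge_bern_small].
Qed.

(** The factor 1/p contributes -1, p^i B_i contributes i, and the j-th power of the principal part
    minus 1 contributes j. *)
Lemma vge_kummer_coef p L k i j : prime p -> (2 < p)%N -> (i.+1 < p)%N ->
  vge p (i%:Z + j%:Z - 1) (kummer_coef p L k i j).
Proof.
move=> pr p2 ip; rewrite (_ : _ - 1 = (-1 + i%:Z) + j%:Z); last ring.
apply: vgeM => //.
  by apply: vgeM => //; [exact: vge_primeV|exact: vge_pX_bern].
rewrite big_nat; apply: vge_sum => // a /andP[a0 ap]; apply: vgeMl => //.
  by apply: vgeMl => //; apply: vge_exp0 => //; apply: vge_nat.
have := vge_exp p _ 1 j pr (vge_principal_part p L a pr p2 a0 ap).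
by rewrite mul1n.
Qed.

(** The product [binp i * binp j] has degree at most i + j, so X^m occurs only where the coefficient
    has valuation at least i + j - 1 >= m - 1. *)
Lemma vge_coef_kummer_poly p L k m : prime p -> (L.+2 < p)%N ->
  vge p (m%:Z - 1) (kummer_poly p L k)`_m.
Proof.
move=> pr Lp; rewrite coef_sum; apply: vge_sum => // i _.
rewrite coef_sum; apply: vge_sum => // j _; rewrite coefZ.
have iL := ltn_ord i; have jL := ltn_ord j.
have [le|gt] := leqP m (i + j).
  apply: (@vge_le _ (i%:Z + j%:Z - 1)) => //; first lia.
  apply: vgeMr => //; first by apply: vge_kummer_coef => //; lia.
  by apply: pvgeM => //; apply: pvge_binp => //; lia.
rewrite nth_default ?mulr0; first exact: vge0.
rewrite (leq_trans (size_polyMleq _ _)) //.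
have := size_binp i; have := size_binp j; lia.
Qed.

Lemma kummer_poly_at0 p L k :
  (kummer_poly p L k).[0] = p%:R^-1 * \sum_(1 <= a < p) (teich p L a)%:R ^+ k.
Proof.
(* Zero is viewed as a natural number so that [horner_binp] applies; C(0, i) C(0, j) leaves only i =
   j = 0. *)
rewrite -[0](mulr0n 1) -/(0%:R) horner_sum.
rewrite big_ord_recl [X in _ + X]big1 ?addr0 => [|i _]; last first.
  by rewrite horner_sum big1 // => j _; rewrite hornerZ hornerM horner_binp bin_small // mul0r mulr0.
rewrite horner_sum big_ord_recl [X in _ + X]big1 ?addr0 => [|i _]; last first.
  by rewrite hornerZ hornerM (horner_binp (lift _ _)) bin_small // !mulr0.
rewrite hornerZ hornerM !horner_binp /= bin0 !mulr1 /kummer_coef expr0 bern0 !mulr1.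
by congr (_ * _); apply: eq_bigr => a _; rewrite !expr0 !mulr1.
Qed.

Lemma vge_kummer_poly p L k n : prime p -> (L.+2 < p)%N -> (0 < n)%N -> n = k %[mod p.-1] ->
  vge p L%:Z (bern n - p%:R ^+ n.-1 * bern n - (kummer_poly p L k).[n%:R]).
Proof.
move=> pr Lp n0 nk; have p2 : (2 < p)%N by lia.
have pn0 := prime_natr_neq0 _ pr.
pose F i := p%:R^-1 * ('C(n, i)%:R * p%:R ^+ i * bern i * unit_powersum p (n - i)).
have -> : bern n - p%:R ^+ n.-1 * bern n = \sum_(i < n.+1) F i.
  rewrite -mulr_sumr -bern_mult_unit ?prime_gt0 //.
  have -> : p%:R ^+ n = p%:R * p%:R ^+ n.-1 :> rat by rewrite -exprS prednK.
  by rewrite mulrBr -mulrA !mulKf.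
have tail1 : vge p L%:Z (\sum_(i < n.+1 + L.+1) F i - \sum_(i < L.+1) F i).
  apply: vge_sum_tail; rewrite ?leq_addl // => i Li.
  rewrite /F; have -> : p%:R^-1 * ('C(n, i)%:R * p%:R ^+ i * bern i * unit_powersum p (n - i))
      = 'C(n, i)%:R * ((p%:R^-1 * (p%:R ^+ i * bern i)) * unit_powersum p (n - i)) by ring.
  apply: vgeMl => //; first exact: vge_nat.
  apply: vgeMr => //; last exact: vge_unit_powersum.
  apply: (@vge_le _ (-1 + (L%:Z + 1))) => //; first lia.
  apply: vgeM => //; first exact: vge_primeV.
  (* For [i = L.+1] the bound i - 1 given by [vge_bern] falls one short; [bern i] is p-integral
     there since [L.+2 < p]. *)
  have [->|ne] := eqVneq i L.+1.
    by apply: (@vge_le _ L.+1%:Z) => //; [lia|apply: vge_pX_bern].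
  apply: (@vge_le _ (i%:Z + -1)) => //; first lia.
  by apply: vgeM => //; [exact: vge_primeX|exact: vge_bern].
have tail2 : vge p L%:Z (\sum_(i < n.+1 + L.+1) F i - \sum_(i < n.+1) F i).
  apply: vge_sum_tail; rewrite ?leq_addr // => i ni.
  by rewrite /F bin_small // !mul0r mulr0; apply: vge0.
have -> : \sum_(i < n.+1) F i - (kummer_poly p L k).[n%:R] =
   (\sum_(i < n.+1 + L.+1) F i - \sum_(i < L.+1) F i)
   - (\sum_(i < n.+1 + L.+1) F i - \sum_(i < n.+1) F i)
   + (\sum_(i < L.+1) F i - (kummer_poly p L k).[n%:R]) by ring.
apply: vgeD => //; first exact: vgeB.
rewrite horner_sum -sumrB; apply: vge_sum => // i _.
have iL := ltn_ord i.
(* For [i > n] both terms vanish with C(n, i); the congruence for a^(n-i) used below requires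
   [i <= n]. *)
have [lt|le] := ltnP n i.
  rewrite /F bin_small // !mul0r mulr0 horner_sum big1 ?subrr; first exact: vge0.
  by move=> j _; rewrite hornerZ hornerM horner_binp bin_small // mul0r mulr0.
pose x a : rat := (principal_part p L a)%:R.
pose t a : rat := (teich p L a)%:R.
pose v a : rat := (inv_mod p L a)%:R.
have -> : F i - (\sum_(j < L.+1) kummer_coef p L k i j *: (binp i * binp j)).[n%:R]
  = p%:R^-1 * (p%:R ^+ i * bern i) * ('C(n, i)%:R *
    \sum_(1 <= a < p) (a%:R ^+ (n - i) - t a ^+ k * v a ^+ i *
        \sum_(j < L.+1) 'C(n, j)%:R * (x a - 1) ^+ j)).
  rewrite sumrB !mulrBr; congr (_ - _); first by rewrite /F /unit_powersum; ring.
  rewrite horner_sum.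
  under [in RHS]eq_bigr => a _ do rewrite mulr_sumr.
  rewrite exchange_big /= !mulr_sumr; apply: eq_bigr => j _.
  rewrite hornerZ hornerM !horner_binp /kummer_coef.
  rewrite -!mulrA; congr (_ * (_ * (_ * _))).
  rewrite mulrCA; congr (_ * _); rewrite mulr_suml; apply: eq_bigr => a _.
  by rewrite /t /v /x; ring.
apply: (@vge_le _ ((-1 + i%:Z) + L.+1%:Z)) => //; first lia.
apply: vgeM => //.
  by apply: vgeM => //; [exact: vge_primeV|apply: vge_pX_bern => //; lia].
apply: vgeMl => //; first exact: vge_nat.
rewrite big_nat; apply: vge_sum => // a /andP[a0 ap].
(* Three errors, each divisible by p^(L+1): inverting a^i, splitting a^n into Teichmueller and
   principal parts, and truncating Newton's series. *)
have -> : a%:R ^+ (n - i) - t a ^+ k * v a ^+ i * \sum_(j < L.+1) 'C(n, j)%:R * (x a - 1) ^+ j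
 = (a%:R ^+ (n - i) - a%:R ^+ n * v a ^+ i)
   + (v a ^+ i * (a%:R ^+ n - t a ^+ k * x a ^+ n)
   + t a ^+ k * v a ^+ i * (x a ^+ n - \sum_(j < L.+1) 'C(n, j)%:R * (x a - 1) ^+ j)) by ring.
apply: vgeD => //; first exact: vge_inv_mod.
have hv := vge_exp0 _ _ i pr (vge_nat p (inv_mod p L a)).
have ht := vge_exp0 _ _ k pr (vge_nat p (teich p L a)).
apply: vgeD => //; apply: vgeMl => //.
- exact: vge_teich_exp.
- exact: vgeMl.
- by apply: vge_newton => //; apply: vge_principal_part.
Qed.

(** Each of the p - 1 summands is 1 modulo [p ^ L.+1]. *)
Lemma vge_powersum_teich1 p L k : prime p -> k = 0 %[mod p.-1] ->
  vge p L%:Z ((kummer_poly p L k).[0] - (1 - p%:R^-1)).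
Proof.
move=> pr k0; have pn0 := prime_natr_neq0 _ pr; rewrite kummer_poly_at0.
have -> : 1 - p%:R^-1 = p%:R^-1 * \sum_(1 <= a < p) 1 :> rat.
  by rewrite sumr_const_nat natrB ?prime_gt0 // mulrBr mulVf // mulr1.
rewrite -mulrBr -sumrB; apply: (@vge_le _ (-1 + L.+1%:Z)) => //; first lia.
apply: vgeM => //; first exact: vge_primeV.
rewrite big_nat; apply: vge_sum => // a /andP[a0 ap].
rewrite -natrX -[1]/(1%:R); apply: vge_modn.
by rewrite (expn_congr _ _ _ _ _ (teich_order p L a pr a0 ap) k0) expn0.
Qed.

(* Multiplication by 2 permutes the residues and multiplies the sum of the [k]-th powers of
   the Teichmueller representatives by [teich p L 2 ^ k]. *)
Lemma vge_powersum_teich0 p L k : prime p -> (2 < p)%N -> 2 ^ k != 1 %[mod p] ->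
  vge p L%:Z (kummer_poly p L k).[0].
Proof.
move=> pr p2 k1; have p0 := prime_gt0 pr; rewrite kummer_poly_at0.
have k0 : (0 < k)%N by case: k k1 => //; rewrite expn0 eqxx.
(* Adding a = 0, whose term vanishes as k > 0, gives an index set stable under doubling modulo p. *)
have -> : \sum_(1 <= a < p) (teich p L a)%:R ^+ k = \sum_(a < p) (teich p L a)%:R ^+ k :> rat.
  rewrite -(big_mkord xpredT (fun a => (teich p L a)%:R ^+ k)) [RHS]big_ltn //.
  by rewrite /teich exp0n ?expn_gt0 ?p0 // expr0n gtn_eqF // add0r.
set S := \sum_(a < p) _.
apply: (@vge_le _ (-1 + L.+1%:Z)) => //; first lia.
apply: vgeM => //; first exact: vge_primeV.
pose h (a : 'I_p) := Ordinal (ltn_pmod (2 * a) p0).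
have hinj : injective h.
  move=> a b /(congr1 val) /= /eqP e; apply: val_inj => /=.
  wlog le : a b e / (a <= b)%N.
    by move=> W; case/orP: (leq_total a b) => le; [apply: W|apply/esym/W; rewrite // eq_sym].
  move: e; rewrite eq_sym eqn_mod_dvd ?leq_mul2l ?le ?orbT // -mulnBr Gauss_dvdr; last first.
    by rewrite prime_coprime // gtnNdvd.
  have bp := ltn_ord b; have [|sp] := posnP (b - a); first lia.
  by rewrite gtnNdvd //; lia.
pose T := teich p L 2.
(* After reindexing, [2 * a] and its remainder agree modulo p, hence their p^L-th powers agree
   modulo [p ^ L.+1]. *)
have eqT : vge p L.+1%:Z (T%:R ^+ k * S - S).
  rewrite {2}/S (reindex_inj hinj) /= mulr_sumr -sumrB; apply: vge_sum => // a _.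
  rewrite -exprMn; apply: vge_subX => //; [apply: vgeMl => //; exact: vge_nat|exact: vge_nat|].
  rewrite -natrM /T /teich -expnMn !natrX; apply: vge_subXpn => //; try exact: vge_nat.
  by apply: (@vge_modn _ 1); rewrite expn1 modn_mod.
have T0 : (0 < T ^ k)%N by rewrite !expn_gt0.
(* As T is 2 modulo p, the hypothesis on 2^k makes T^k - 1 a p-adic unit, and S can be recovered
   from T^k S - S. *)
have cT : coprime p (T ^ k - 1).
  rewrite prime_coprime // -eqn_mod_dvd //.
  apply: contra k1 => /eqP <-; rewrite -modnXm -[in X in _ == X]modnXm.
  apply/eqP; congr ((_ ^ _) %% _)%N; rewrite /T /teich.
  elim: L {S T eqT T0} => [|L IH]; first by rewrite expn0 expn1.
  rewrite expnSr expnM -[RHS]modnXm -IH modnXm -{2}(prednK p0) expnS.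
  rewrite -modnMmr -(totient_prime pr) Euler_exp_totient ?modnMmr ?muln1 //.
  by rewrite coprime_sym prime_coprime // gtnNdvd.
have -> : S = (T ^ k - 1)%:R^-1 * (T%:R ^+ k * S - S).
  rewrite -{3}[S]mul1r -mulrBl mulrA natrB // natrX mulVf ?mul1r //.
  by rewrite -natrX -natrB // (coprime_natr_neq0 p).
by apply: vgeMl => //; apply: vge_natV.
Qed.

(** * Evaluating rational functions at large primes *)

Local Notation num x := (frac (repr x)).1.
Local Notation den x := (frac (repr x)).2.

Lemma ratfun_den_neq0 (x : ratfun) : den x != 0.
Proof. exact: denom_ratioP. Qed.

(** [vt] and [feval] are defined from the representative chosen by [repr]; this identity says that
    it does represent x. *)
Lemma ratfunE (x : ratfun) : x = tofrac (num x) / tofrac (den x).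
Proof.
have d0 : tofrac (den x) != 0 :> ratfun by rewrite tofrac_eq0 ratfun_den_neq0.
apply: (mulIf d0); rewrite divfK //.
rewrite -{1}[x]reprK; unlock tofrac; rewrite -[LHS]FracField.pi_mul.
apply/eqmodP; rewrite /= FracField.equivfE /FracField.mulf.
by rewrite !numden_Ratio ?mulf_neq0 ?oner_neq0 ?ratfun_den_neq0 // !mulr1 mulrC.
Qed.

Definition for_large_primes (Q : nat -> Prop) : Prop :=
  exists P : nat, forall p : nat, prime p -> (P < p)%N -> Q p.

Lemma flp_gt (m : nat) : for_large_primes (fun p => (m < p)%N).
Proof. by exists m. Qed.

Lemma flp_imp (Q Q' : nat -> Prop) :
  for_large_primes Q -> (forall p, prime p -> Q p -> Q' p) -> for_large_primes Q'.
Proof. by move=> [P hP] h; exists P => p pr Pp; apply/h/hP. Qed.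

Lemma flp_and (Q Q' : nat -> Prop) :
  for_large_primes Q -> for_large_primes Q' -> for_large_primes (fun p => Q p /\ Q' p).
Proof.
move=> [P hP] [P' hP']; exists (maxn P P') => p pr; rewrite gtn_max => /andP[h h'].
by split; [apply: hP|apply: hP'].
Qed.

Lemma flp_forall (I : finType) (Q : I -> nat -> Prop) :
  (forall i, for_large_primes (Q i)) -> for_large_primes (fun p => forall i, Q i p).
Proof.
move=> h; suff : for_large_primes (fun p => forall i, i \in enum I -> Q i p).
  by move/flp_imp; apply => p _ hp i; apply: hp; rewrite mem_enum.
elim: (enum I) => [|i s IH]; first by exists 0%N.
apply: flp_imp (flp_and _ _ (h i) IH) _ => p _ [hi hs] j.
by rewrite inE => /predU1P[->|/hs].
Qed.

Lemma horner_intpoly (f : {poly int}) (z : int) :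
  (map_poly (fun z : int => z%:~R : rat) f).[z%:~R] = (f.[z])%:~R.
Proof. by rewrite -[map_poly _ f]/(map_poly intr f) horner_map. Qed.

(** Used twice: f(p) is f(0) modulo p, and f(p) is f(1) modulo p - 1. *)
Lemma dvdz_horner_sub (f : {poly int}) (x y : int) : (x - y %| f.[x] - f.[y])%Z.
Proof.
have /factor_theorem [q hq] : root (f - f.[y]%:P) y by rewrite /root !hornerE subrr.
have -> : f.[x] - f.[y] = (f - f.[y]%:P).[x] by rewrite !hornerE.
rewrite hq hornerM hornerXsubC.
exact: dvdz_mull.
Qed.

(** Clearing denominators, q = z / D with z integral. As z(p) is z(0) modulo p, neither z(p) nor D
    is divisible by p once p exceeds |z(0)| + |D|. *)
Lemma flp_horner_unit (q : {poly rat}) : q.[0] != 0 -> for_large_primes (fun p =>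
  [/\ vge p 0 q.[p%:R], q.[p%:R] != 0 & vge p 0 (q.[p%:R])^-1]).
Proof.
have [z [D D0 ->]] := rat_poly_scale q.
have hz (x : int) : (D%:~R^-1 *: map_poly intr z).[x%:~R] = D%:~R^-1 * (z.[x])%:~R :> rat.
  by rewrite hornerZ; congr (_ * _); apply: (horner_intpoly z).
rewrite (hz 0) => h0; have z0 : z.[0] != 0.
  by apply: contraNneq h0 => ->; rewrite mulr0.
apply: flp_imp (flp_gt (`|z.[0]| + `|D|)) _ => p pr lt; rewrite (hz p).
have cop (x : int) : x != 0 -> (`|x| < p)%N -> coprime p `|x|.
  by move=> x0 xp; rewrite prime_coprime // gtnNdvd // absz_gt0.
have cD : coprime p `|D| by apply: cop => //; lia.
have cz : coprime p `|z.[p]|.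
  rewrite prime_coprime //; apply/negP => d.
  have := cop _ z0; rewrite prime_coprime //; move/(_ _)/negP; apply; first lia.
  have := dvdz_horner_sub z p 0; rewrite subr0 => d'.
  have : (p %| z.[p] - (z.[p] - z.[0]))%Z by rewrite rpredB.
  by rewrite opprB addrC subrK.
have V (x : int) : coprime p `|x| -> vge p 0 x%:~R^-1.
  move=> cx; have := vge_natV _ _ pr cx; case: (intP x) => [|m|m] //.
  by rewrite abszN /= mulrNz invrN => h; apply: vgeN.
have nz (x : int) : coprime p `|x| -> x%:~R != 0 :> rat.
  by move=> cx; have := coprime_natr_neq0 _ _ pr cx; rewrite pnatr_eq0 absz_eq0 intr_eq0.
split.
- by apply: vgeMl; rewrite ?V //; [apply: V|apply: vge_int].
- by rewrite mulf_neq0 ?invr_eq0 ?nz.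
- by rewrite invfM invrK; apply: vgeMl => //; [apply: vge_int|apply: V].
Qed.

Lemma polyX_factor (q : {poly rat}) : q != 0 ->
  exists2 r : {poly rat}, r.[0] != 0 & q = r * 'X ^+ (mup 0 q).
Proof.
move=> q0; have X0 : 'X - 0%:P = 'X :> {poly rat} by rewrite subr0.
have : 'X ^+ mup 0 q %| q by rewrite -{1}X0 -mup_geq.
move/dvdpP => [r hr]; exists r => //.
apply/negP => /factor_theorem[s hs].
have := mup_geq 0 (mup 0 q).+1 q0; rewrite ltnn => /esym/negP; apply.
by rewrite X0 [X in _ %| X]hr hs X0 exprS -mulrA dvdp_mull.
Qed.

Lemma flp_horner_neq0 (q : {poly rat}) : q != 0 -> for_large_primes (fun p => q.[p%:R] != 0).
Proof.
move=> q0; have [r r0 ->] := polyX_factor q q0.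
apply: flp_imp (flp_horner_unit r r0) _ => p pr [_ rp _].
by rewrite hornerM hornerXn mulf_neq0 // expf_neq0 // prime_natr_neq0.
Qed.

(** Passage from t-adic to p-adic valuations: the cofactors left after splitting off the powers of X
    from numerator and denominator take p-adic unit values at large p. *)
Lemma flp_vge_feval (x : ratfun) (K : int) : vt_ge x K ->
  for_large_primes (fun p => vge p K (feval x p)).
Proof.
rewrite /vt_ge /vt_opt /vt /feval; have [-> _|x0] := eqVneq x 0.
  exists 0%N => p _ _; have -> : num (0 : ratfun) = 0; last by rewrite horner0 mul0r; apply: vge0.
  have /eqP := ratfunE 0; rewrite eq_sym mulf_eq0 invr_eq0 !tofrac_eq0 (negPf (ratfun_den_neq0 _)) orbF.
  by move/eqP.
have n0 : num x != 0.
  by apply: contraNneq x0 => h; rewrite [x]ratfunE h rmorph0 mul0r.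
have [r r0 hr] := polyX_factor _ n0; have [s s0 hs] := polyX_factor _ (ratfun_den_neq0 x).
move: hr hs; move: (num x) (den x) => a b; move: (mup 0 a) (mup 0 b) => d e -> -> le.
apply: flp_imp (flp_and _ _ (flp_horner_unit r r0) (flp_horner_unit s s0)) _.
move=> p pr [[hr _ _] [_ _ hs]]; apply: (vge_le _ _ _ _ pr le).
rewrite !hornerM !hornerXn invfM mulrACA; apply: vgeMl => //; first exact: vgeMl.
by apply: vgeM => //; [apply: vge_primeX|rewrite exprnP invr_expz; apply: vge_expz].
Qed.

(** [feval] depends on a chosen representative and need not commute with ring operations at every p;
    it does so for large p, and this relation expresses that. *)
Definition evals (x : ratfun) (h : nat -> rat) : Prop :=
  for_large_primes (fun p => feval x p%:Z = h p).

Lemma evals_frac (a b : {poly rat}) : b != 0 ->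
  evals (tofrac a / tofrac b) (fun p => a.[p%:R] / b.[p%:R]).
Proof.
move=> b0; set x := _ / _; have d0 := ratfun_den_neq0 x.
have e : num x * b = a * den x.
  have := ratfunE x; rewrite {1}/x => /eqP.
  by rewrite eqr_div ?tofrac_eq0 // -!rmorphM tofrac_eq => /eqP ->.
apply: flp_imp (flp_and _ _ (flp_horner_neq0 b b0) (flp_horner_neq0 _ d0)) _ => p pr [hb hd].
apply/eqP; rewrite /feval eqr_div // -!hornerM e; exact: eqxx.
Qed.

Lemma evals_poly (a : {poly rat}) : evals (tofrac a) (fun p => a.[p%:R]).
Proof.
apply: flp_imp (evals_frac a 1 (oner_neq0 _)) _ => p _.
by rewrite rmorph1 !divr1 hornerC divr1.
Qed.

Lemma evals_feval (x : ratfun) : evals x (fun p => feval x p%:Z).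
Proof. by exists 0%N. Qed.

Lemma flp_feval_frac (x : ratfun) : for_large_primes (fun p =>
  [/\ (num x).[p%:R] = feval x p * (den x).[p%:R] & (den x).[p%:R] != 0]).
Proof.
apply: flp_imp (flp_horner_neq0 _ (ratfun_den_neq0 x)) _ => p _ d0.
by split=> //; rewrite /feval divfK.
Qed.

Lemma evalsD x y h k : evals x h -> evals y k -> evals (x + y) (fun p => h p + k p).
Proof.
move=> hx hy; have dx := ratfun_den_neq0 x; have dy := ratfun_den_neq0 y.
have := evals_frac (num x * den y + num y * den x) (den x * den y) (mulf_neq0 dx dy).
rewrite [tofrac _ / _](_ : _ = x + y); last first.
  by rewrite [in RHS](ratfunE x) [in RHS](ratfunE y) addf_div ?tofrac_eq0 // -!rmorphM -rmorphD.
move=> hxy; apply: flp_imp (flp_and _ _ (flp_and _ _ hx hy)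
  (flp_and _ _ hxy (flp_and _ _ (flp_feval_frac x) (flp_feval_frac y)))) _.
move=> p _ [[<- <-] [-> [[ex d0] [ey e0]]]].
by rewrite hornerD !hornerM ex ey; field; rewrite d0 e0.
Qed.

Lemma evalsM x y h k : evals x h -> evals y k -> evals (x * y) (fun p => h p * k p).
Proof.
move=> hx hy; have dx := ratfun_den_neq0 x; have dy := ratfun_den_neq0 y.
have := evals_frac (num x * num y) (den x * den y) (mulf_neq0 dx dy).
rewrite [tofrac _ / _](_ : _ = x * y); last first.
  by rewrite [in RHS](ratfunE x) [in RHS](ratfunE y) mulf_div -!rmorphM.
move=> hxy; apply: flp_imp (flp_and _ _ (flp_and _ _ hx hy)
  (flp_and _ _ hxy (flp_and _ _ (flp_feval_frac x) (flp_feval_frac y)))) _.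
move=> p _ [[<- <-] [-> [[ex d0] [ey e0]]]].
by rewrite !hornerM ex ey; field; rewrite d0 e0.
Qed.

Lemma evals_ratc c : evals (ratc c) (fun=> c).
Proof. by apply: flp_imp (evals_poly c%:P) _ => p _ ->; rewrite hornerC. Qed.

Lemma evals1 : evals 1 (fun=> 1).
Proof. by have := evals_ratc 1; rewrite /ratc polyC1 rmorph1. Qed.

Lemma evals0 : evals 0 (fun=> 0).
Proof. by have := evals_ratc 0; rewrite /ratc polyC0 rmorph0. Qed.

Lemma evalsN x h : evals x h -> evals (- x) (fun p => - h p).
Proof.
move=> hx; have := evalsM _ _ _ _ (evals_ratc (-1)) hx.
rewrite /ratc polyCN rmorphN polyC1 rmorph1 mulN1r => hN.
by apply: flp_imp hN _ => p _ ->; rewrite mulN1r.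
Qed.

Lemma evalsB x y h k : evals x h -> evals y k -> evals (x - y) (fun p => h p - k p).
Proof. by move=> hx hy; apply: evalsD => //; apply: evalsN. Qed.

Lemma evalsX x h m : evals x h -> evals (x ^+ m) (fun p => h p ^+ m).
Proof.
move=> hx; elim: m => [|m IH]; first exact: evals1.
apply: flp_imp (evalsM _ _ _ _ hx IH) _ => p _; by rewrite -!exprS.
Qed.

Lemma evals_sum (I : Type) (r : seq I) (P : pred I) (x : I -> ratfun) (h : I -> nat -> rat) :
  (forall i, P i -> evals (x i) (h i)) ->
  evals (\sum_(i <- r | P i) x i) (fun p => \sum_(i <- r | P i) h i p).
Proof.
move=> hx; elim: r => [|i r IH].
  by rewrite big_nil; apply: flp_imp evals0 _ => p _ ->; rewrite big_nil.
rewrite big_cons; case: ifP => Pi.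
  by apply: flp_imp (evalsD _ _ _ _ (hx i Pi) IH) _ => p _ ->; rewrite big_cons Pi.
by apply: flp_imp IH _ => p _ ->; rewrite big_cons Pi.
Qed.

Lemma evals_tvar : evals tvar (fun p => p%:R).
Proof. by apply: flp_imp (evals_poly 'X) _ => p _ ->; rewrite hornerX. Qed.

Lemma evals_tvarV : evals tvar^-1 (fun p => p%:R^-1).
Proof.
have := evals_frac 1 'X; rewrite polyX_eq0 rmorph1 div1r => /(_ isT) h.
by apply: flp_imp h _ => p _ ->; rewrite hornerX hornerC div1r.
Qed.

Lemma evals_intpoly (f : {poly int}) :
  evals (ratfun_of_intpoly f) (fun p => (f.[p%:Z])%:~R).
Proof.
have h := evals_poly (map_poly (fun z : int => z%:~R : rat) f).
by apply: flp_imp h _ => p _ ->; rewrite -(horner_intpoly f p).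
Qed.

Lemma flp_vge_evals x K h : vt_ge x K -> evals x h -> for_large_primes (fun p => vge p K (h p)).
Proof.
by move=> /flp_vge_feval h1 h2; apply: flp_imp (flp_and _ _ h1 h2) _ => p _ [+ <-].
Qed.

(** * The congruence at a fixed prime *)

(** In Horner form f = q X + c with q nonzero, q(p) >= 1 by induction, so f(p) >= p - |c|. The
    second bound later makes f_i(p) exceed a given number. *)
Lemma horner_int_growth (f : {poly int}) : 0 < lead_coef f -> exists C : nat,
  forall p : nat, (C < p)%N -> 1 <= f.[p%:Z] /\ ((1 < size f)%N -> p%:Z <= f.[p%:Z] + C%:Z).
Proof.
elim/poly_ind: f => [|q c IH]; first by rewrite lead_coef0.
have [-> |q0] := eqVneq q 0.
  rewrite mul0r add0r lead_coefC => c0; exists 0%N => p _; rewrite hornerC.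
  by split; [lia|rewrite size_polyC; case: (c != 0)].
have lq : lead_coef (q * 'X + c%:P) = lead_coef q.
  rewrite lead_coefDl ?lead_coefMX // size_polyC size_mulX //.
  by rewrite (leq_ltn_trans (leq_b1 _)) // ltnS size_poly_gt0.
rewrite lq => /IH[C hC]; exists (C + `|c|).+1%N => p lt; rewrite !hornerE.
have [h1 _] : 1 <= q.[p%:Z] /\ _ := hC p ltac:(lia).
have h2 : p%:Z <= q.[p%:Z] * p%:Z by apply: ler_peMl.
move: h2; set y := _ * _; by split=> [|_]; lia.
Qed.

(** A natural exponent standing for [k], which may be negative, as an argument of [kummer_poly]. *)
Definition residue (p : nat) (k : int) : nat := `|(k %% (p.-1)%:Z)%Z|%N.

Lemma residue_eq p (k F : int) : (1 < p)%N -> 0 <= F -> ((p.-1)%:Z %| F - k)%Z ->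
  `|F|%N = residue p k %[mod p.-1].
Proof.
case: F => // m _ _; rewrite -eqz_mod_dvd => /eqP e.
by rewrite /residue -e modz_nat /= modn_mod.
Qed.

Lemma vge_sum_fibers p K (n : nat) (key : 'I_n -> int) (h : 'I_n -> rat) : prime p ->
  (forall j, vge p K (\sum_(i | key i == key j) h i)) -> vge p K (\sum_i h i).
Proof.
move=> pr hk; pose s := undup [seq key i | i <- enum 'I_n].
have -> : \sum_i h i = \sum_(k <- s) \sum_(i | key i == k) h i.
  rewrite (exchange_big_dep xpredT) //=; apply: eq_bigr => i _.
  rewrite -big_filter (eq_filter (a2 := pred1 (key i))); last by move=> k; rewrite /= eq_sym.
  by rewrite filter_pred1_uniq ?undup_uniq ?big_seq1 // mem_undup map_f ?mem_enum.
rewrite big_seq; apply: vge_sum => // k.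
by rewrite mem_undup => /mapP[j _ ->]; apply: hk.
Qed.

Lemma residue0 p : residue p 0 = 0%N.
Proof. by rewrite /residue mod0z. Qed.

(** As 1 < 2^|k| < p for nonzero k, 2^|k| is not 1 modulo p; for negative k the power in question is
    its inverse. *)
Lemma expn2_residue p (k : int) : prime p -> (2 < p)%N -> k != 0 -> (2 ^ `|k| < p)%N ->
  2 ^ residue p k != 1 %[mod p].
Proof.
move=> pr p2 k0 lt; have q0 : (p.-1)%:Z != 0 by lia.
have ord : 2 ^ p.-1 = 1 %[mod p].
  by rewrite -(totient_prime pr) Euler_exp_totient // coprime_sym prime_coprime // gtnNdvd.
have small : 2 ^ `|k| != 1 %[mod p].
  rewrite !modn_small ?prime_gt1 // -[1%N](expn0 2) eqn_exp2l // absz_eq0; exact: k0.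
case: k k0 lt small => m k0 lt.
  by rewrite /residue modz_nat /= (expn_congr _ _ _ _ _ ord (modn_mod m p.-1)).
apply: contra => /eqP h; apply/eqP.
rewrite -[X in (X %% p)%N = _]muln1 -modnMmr -h modnMmr -expnD.
have : `|Negz m| + residue p (Negz m) = 0 %[mod p.-1].
  have : (`|Negz m| + residue p (Negz m))%N%:Z = - ((Negz m %/ p.-1)%Z * p.-1%:Z).
    rewrite PoszD /residue [`|(_ %% _)%Z|%N%:Z]gez0_abs ?modz_ge0 //.
    have := divz_eq (Negz m) (p.-1)%:Z; move: (_ %/ _)%Z (_ %% _)%Z => d r e.
    by rewrite -[d * _](addrK r) -e; lia.
  by move/(congr1 absz); rewrite abszN abszM !absz_nat => ->; rewrite modnMl mod0n.
by move=> e; rewrite (expn_congr _ _ _ _ _ ord e) expn0.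
Qed.

Lemma vge_kummer_at0 p L k : prime p -> (L.+2 < p)%N -> (2 ^ `|k| < p)%N ->
  vge p L%:Z ((kummer_poly p L (residue p k)).[0] - (if k == 0 then 1 - p%:R^-1 else 0)).
Proof.
move=> pr Lp kp; have [->|k0] := eqVneq k 0.
  by apply: vge_powersum_teich1; rewrite ?residue0.
by rewrite subr0; apply: vge_powersum_teich0; [| |apply: expn2_residue]; rewrite //; lia.
Qed.

(** The Euler factor is kept because the statement is also applied at F = k, which is not large. *)
Lemma vge_kummer_bernz p L k (F : int) : prime p -> (L.+2 < p)%N -> 0 < F -> ((p.-1)%:Z %| F - k)%Z ->
  vge p L%:Z (bernz F - p%:R ^+ `|F|.-1 * bernz F - (kummer_poly p L (residue p k)).[F%:~R]).
Proof.
move=> pr Lp F0 hF; rewrite /bernz ltW //.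
have -> : F%:~R = `|F|%N%:R :> rat by rewrite pmulrn gtz0_abs.
apply: vge_kummer_poly; rewrite // ?absz_gt0 ?gt_eqF //.
by apply: residue_eq; rewrite ?ltW // prime_gt1.
Qed.

(** For [F >= L + 2] the Euler factor may be dropped: p^(F-1) B_F has valuation at least F - 2 >=
    L. *)
Lemma vge_kummer_bernz_large p L k (F : int) : prime p -> (L.+2 < p)%N ->
  (L.+2)%:Z <= F -> ((p.-1)%:Z %| F - k)%Z ->
  vge p L%:Z (bernz F - (kummer_poly p L (residue p k)).[F%:~R]).
Proof.
move=> pr Lp F0 hF; set c := (kummer_poly _ _ _).[_].
have h : vge p L%:Z (bernz F - p%:R ^+ `|F|.-1 * bernz F - c).
  by apply: vge_kummer_bernz => //; lia.
have -> : bernz F - c = (bernz F - p%:R ^+ `|F|.-1 * bernz F - c)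
   + p%:R ^+ `|F|.-1 * bernz F by ring.
apply: vgeD => //; apply: (@vge_le _ (`|F|.-1%:Z + -1)) => //; first lia.
apply: vgeM => //; first exact: vge_primeX.
rewrite /bernz; case: ifP => _; [exact: vge_bern|exact: vge0].
Qed.

Lemma horner_sub0 (q : {poly rat}) x :
  q.[x] = q.[0] + \sum_(m < (size q).-1) q`_m.+1 * x ^+ m.+1.
Proof.
rewrite (horner_coef_wide x (leqSpred (size q))) big_ord_recl expr0 mulr1 horner_coef0.
by congr (_ + _); apply: eq_bigr.
Qed.

(* The part of [B_F] accounted for by the first condition when [F = k] modulo [p.-1]. *)
Definition main_term (p : nat) (k F : int) : rat :=
  (if k == 0 then 1 - p%:R^-1 else 0) +
  (if 2 <= k then (1 - p%:R ^+ `|k|.-1) * (bernz k / k%:~R) * F%:~R else 0).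

Lemma bernz_odd (k : int) : ~~ (2 %| k)%Z -> 2 <= k -> bernz k = 0.
Proof. by case: k => // k k2 le; apply: bern_odd; move: k2 le; lia. Qed.

(** When the interpolating polynomial is expanded at F_i, its constant term gives the main term, and
    the coefficient of F_i^m, divisible by p^(m-1), multiplies a sum divisible by p^(N+1-m). *)
Lemma vge_fiber_nonpos p (L : nat) (M N : int) n (k : int) (F : 'I_n -> int) (G : 'I_n -> rat)
    (P : pred 'I_n) : prime p -> (L.+2 < p)%N -> (2 ^ `|k| < p)%N -> N - M <= L%:Z -> k <= 0 ->
  (forall i, vge p M (G i)) ->
  (forall i, P i -> (L.+2)%:Z <= F i /\ ((p.-1)%:Z %| F i - k)%Z) ->
  (forall m : nat, (1 <= m)%N -> m%:Z <= N - M ->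
     vge p (N + 1 - m%:Z) (\sum_(i | P i) G i * (F i)%:~R ^+ m)) ->
  vge p N (\sum_(i | P i) G i * (bernz (F i) - main_term p k (F i))).
Proof.
move=> pr Lp kp NM k0 hG hF hm; pose c := kummer_poly p L (residue p k).
have -> : \sum_(i | P i) G i * (bernz (F i) - main_term p k (F i)) =
  \sum_(i | P i) G i * (bernz (F i) - c.[(F i)%:~R] + (c.[0] - (if k == 0 then 1 - p%:R^-1 else 0)))
  + \sum_(m < (size c).-1) c`_m.+1 * \sum_(i | P i) G i * (F i)%:~R ^+ m.+1.
  under [X in _ = _ + X]eq_bigr => m _ do rewrite mulr_sumr.
  rewrite exchange_big -big_split; apply: eq_bigr => i _ /=.
  rewrite [in RHS](horner_sub0 c (F i)%:~R) /main_term [if 2 <= k then _ else _]ifF ?addr0; last lia.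
  have -> : \sum_(m < (size c).-1) c`_m.+1 * (G i * (F i)%:~R ^+ m.+1) =
    G i * \sum_(m < (size c).-1) c`_m.+1 * (F i)%:~R ^+ m.+1.
    by rewrite mulr_sumr; apply: eq_bigr => m _; ring.
  by move: (\sum_(m < _) _) => y; case: ifP => _; ring.
apply: vgeD => //; (apply: vge_sum => //); [move=> i Pi|move=> m _].
  have [F0 Fk] := hF i Pi; apply: (@vge_le _ (M + L%:Z)) => //; first lia.
  apply: vgeM => //; apply: vgeD => //; first exact: vge_kummer_bernz_large.
  exact: vge_kummer_at0.
have hc : vge p (m.+1%:Z - 1) c`_m.+1 by apply: vge_coef_kummer_poly.
(* For exponents above N - M, the divisibility of the coefficient together with the bound [M] on [G]
   already yields p^N. *)
have [le|gt] := lerP (m.+1%:Z) (N - M).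
  apply: (@vge_le _ ((m.+1%:Z - 1) + (N + 1 - m.+1%:Z))) => //; first lia.
  by apply: vgeM => //; apply: hm.
apply: (@vge_le _ ((m.+1%:Z - 1) + M)) => //; first lia.
apply: vgeM => //; apply: vge_sum => // i _; apply: vgeMr => //.
by apply: vge_exp0 => //; apply: vge_int.
Qed.

(** The linear coefficient of the interpolating polynomial c is not controlled, but modulo p^L, c(k)
    is (1 - p^(k-1)) B_k and c(0) is 0. Subtracting (F/k) c(k) from c(F) removes it and turns F^m
    into F^m - k^(m-1) F. *)
Lemma vge_fiber_pos p (L : nat) (M N : int) n (k : int) (F : 'I_n -> int) (G : 'I_n -> rat)
    (P : pred 'I_n) : prime p -> (L.+2 < p)%N -> (2 ^ `|k| < p)%N -> N - M <= L%:Z -> 2 <= k ->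
  (forall i, vge p M (G i)) ->
  (forall i, P i -> (L.+2)%:Z <= F i /\ ((p.-1)%:Z %| F i - k)%Z) ->
  (forall m : nat, (2 <= m)%N -> m%:Z <= N - M ->
     vge p (N + 1 - m%:Z)
       (\sum_(i | P i) G i * ((F i)%:~R ^+ m - k%:~R ^+ m.-1 * (F i)%:~R))) ->
  vge p N (\sum_(i | P i) G i * (bernz (F i) - main_term p k (F i))).
Proof.
move=> pr Lp kp NM k2 hG hF hm; pose c := kummer_poly p L (residue p k).
pose K : rat := k%:~R; have K0 : K != 0 by rewrite intr_eq0; lia.
(* From k < 2^k < p, k is a p-adic unit. *)
have vK : vge p 0 K^-1.
  have := ltn_expl `|k| (ltnSn 1) => lt.
  rewrite /K -(@gtz0_abs k); last lia.
  by apply: vge_natV => //; rewrite prime_coprime // gtnNdvd; lia.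
(* The interpolation error at [k] itself, divisible by p^L. *)
pose ck := bernz k - p%:R ^+ `|k|.-1 * bernz k - c.[K].
have -> : \sum_(i | P i) G i * (bernz (F i) - main_term p k (F i)) =
  \sum_(i | P i) G i * (bernz (F i) - c.[(F i)%:~R]
    + (c.[0] * (1 - (F i)%:~R * K^-1) - (F i)%:~R * K^-1 * ck))
  + \sum_(m < (size c).-1) c`_m.+1 * \sum_(i | P i) G i * ((F i)%:~R ^+ m.+1 - K ^+ m * (F i)%:~R).
  under [X in _ = _ + X]eq_bigr => m _ do rewrite mulr_sumr.
  rewrite exchange_big -big_split; apply: eq_bigr => i _ /=.
  rewrite /main_term k2 ifF ?add0r; last lia.
  have -> : \sum_(m < (size c).-1) c`_m.+1 * (G i * ((F i)%:~R ^+ m.+1 - K ^+ m * (F i)%:~R)) =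
    G i * (c.[(F i)%:~R] - c.[0] - (c.[K] - c.[0]) * K^-1 * (F i)%:~R).
    rewrite (horner_sub0 c (F i)%:~R) (horner_sub0 c K) ![c.[0] + _]addrC !addrK.
    rewrite -mulrA mulr_suml -sumrB mulr_sumr; apply: eq_bigr => m _.
    by rewrite exprS [K ^+ m.+1]exprS; field.
  rewrite /ck -/K; ring.
apply: vgeD => //; (apply: vge_sum => //); [move=> i Pi|move=> [m ms] _ /=].
  have [F0 Fk] := hF i Pi; apply: (@vge_le _ (M + L%:Z)) => //; first lia.
  have vF : vge p 0 ((F i)%:~R * K^-1) by apply: vgeMl => //; apply: vge_int.
  apply: vgeM => //; apply: vgeD => //; first exact: vge_kummer_bernz_large.
  apply: vgeB => //.
    apply: vgeMr => //; last by apply: vgeB => //; apply: (vge_nat p 1).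
    have := vge_kummer_at0 p L k pr Lp kp; rewrite (_ : k == 0 = false) ?subr0 //; lia.
  apply: vgeMl => //; apply: vge_kummer_bernz => //; first lia.
  by rewrite subrr dvdz0.
(* The linear term cancels identically: F - k^0 F = 0. *)
case: m ms => [|m] ms.
  rewrite big1 ?mulr0; first exact: vge0.
  by move=> i _; rewrite expr0 expr1 mul1r subrr mulr0.
have hc : vge p (m.+2%:Z - 1) c`_m.+2 by apply: vge_coef_kummer_poly.
have [le|gt] := lerP (m.+2%:Z) (N - M).
  apply: (@vge_le _ ((m.+2%:Z - 1) + (N + 1 - m.+2%:Z))) => //; first lia.
  by apply: vgeM => //; apply: (hm m.+2).
apply: (@vge_le _ ((m.+2%:Z - 1) + M)) => //; first lia.
apply: vgeM => //; apply: vge_sum => // i _; apply: vgeMr => //.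
have vF r : vge p 0 ((F i)%:~R ^+ r) by apply: vge_exp0 => //; apply: vge_int.
apply: vgeB => //; apply: vgeMl => //; last exact: vge_int.
by apply: vge_exp0 => //; apply: vge_int.
Qed.

(** As p - 1 is even, F has the parity of k, and Bernoulli numbers vanish at odd indices above 1.
    This is why the second and third conditions concern even k only. *)
Lemma bernz_main_term_odd p (k F : int) : prime p -> (2 < p)%N -> 2 <= F ->
  ((p.-1)%:Z %| F - k)%Z -> ~~ (2 %| k)%Z -> bernz F - main_term p k F = 0.
Proof.
move=> pr p2 F2 Fk ok.
have p_odd : odd p by case/even_prime: (pr) p2 => [->|].
have d2 : (2 %| F - k)%Z.
  by apply: dvdz_trans Fk; rewrite /dvdz /=; lia.
rewrite bernz_odd //; last by apply: contra ok => F_even; rewrite -[k](subKr F) rpredB.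
rewrite /main_term; case: eqP ok => [->|_] ok; first by rewrite dvdz0 in ok.
by case: ifP => [k2|_]; rewrite ?bernz_odd // ?mul0r ?mulr0 ?mul0r ?addr0 ?subrr.
Qed.

Lemma bernoulli_congr_at (p L : nat) (M N : int) n (key F : 'I_n -> int) (G : 'I_n -> rat)
    (G0 : rat) : prime p -> (L.+2 < p)%N -> N - M <= L%:Z ->
  (forall i, (2 ^ `|key i| < p)%N) ->
  (forall i, (L.+2)%:Z <= F i) -> (forall i, ((p.-1)%:Z %| F i - key i)%Z) ->
  (forall i, vge p M (G i)) ->
  vge p N (G0 - (1 - p%:R^-1) * (\sum_(i | key i == 0) G i)
     - \sum_(i | 2 <= key i) (1 - p%:R ^+ `|key i|.-1) * (bernz (key i) / (key i)%:~R)
         * G i * (F i)%:~R) ->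
  (forall j, (2 %| key j)%Z -> key j <= 0 -> forall m : nat, (1 <= m)%N -> m%:Z <= N - M ->
     vge p (N + 1 - m%:Z) (\sum_(i | key i == key j) G i * (F i)%:~R ^+ m)) ->
  (forall j, (2 %| key j)%Z -> 0 < key j -> forall m : nat, (2 <= m)%N -> m%:Z <= N - M ->
     vge p (N + 1 - m%:Z) (\sum_(i | key i == key j)
        G i * ((F i)%:~R ^+ m - (key j)%:~R ^+ m.-1 * (F i)%:~R))) ->
  vge p N (\sum_i G i * bernz (F i) - G0).
Proof.
move=> pr Lp NM hk hF hFk hG h1 h2 h3.
(* The main terms add up to the expression of the first condition; the differences are then treated
   on each fibre of [key]. *)
have -> : \sum_i G i * bernz (F i) - G0 =
  \sum_i G i * (bernz (F i) - main_term p (key i) (F i)) -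
  (G0 - (1 - p%:R^-1) * (\sum_(i | key i == 0) G i)
     - \sum_(i | 2 <= key i) (1 - p%:R ^+ `|key i|.-1) * (bernz (key i) / (key i)%:~R)
         * G i * (F i)%:~R).
  under [in RHS]eq_bigr => i _ do rewrite mulrBr /main_term mulrDr.
  rewrite sumrB big_split /= mulr_sumr.
  have -> : \sum_i G i * (if key i == 0 then 1 - p%:R^-1 else 0) =
            \sum_(i | key i == 0) (1 - p%:R^-1) * G i.
    by rewrite [RHS]big_mkcond; apply: eq_bigr => i _; case: ifP => _; rewrite ?mulr0 // mulrC.
  have -> : \sum_i G i * (if 2 <= key i
      then (1 - p%:R ^+ `|key i|.-1) * (bernz (key i) / (key i)%:~R) * (F i)%:~R else 0)
    = \sum_(i | 2 <= key i) (1 - p%:R ^+ `|key i|.-1) * (bernz (key i) / (key i)%:~R) * G i * (F i)%:~R.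
    by rewrite [RHS]big_mkcond; apply: eq_bigr => i _; case: ifP => _; rewrite ?mulr0 //; ring.
  ring.
apply: vgeB => //; apply: (vge_sum_fibers p N n key) => // j.
have -> : \sum_(i | key i == key j) G i * (bernz (F i) - main_term p (key i) (F i)) =
          \sum_(i | key i == key j) G i * (bernz (F i) - main_term p (key j) (F i)).
  by apply: eq_bigr => i /eqP ->.
have hF' i : key i == key j -> (L.+2)%:Z <= F i /\ ((p.-1)%:Z %| F i - key j)%Z.
  by move=> /eqP <-.
have [ev|od] := boolP (2 %| key j)%Z; last first.
  rewrite big1; first exact: vge0.
  move=> i /hF'[Fi Fj]; rewrite bernz_main_term_odd ?mulr0 //; first lia.
  by apply: le_trans Fi; lia.
have [kj|kj] := lerP (key j) 0.
  by apply: (vge_fiber_nonpos p L M N) => //; apply: h2.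
apply: (vge_fiber_pos p L M N) => //; last exact: h3.
by move: ev kj; lia.
Qed.

(** * From conditions on rational functions to all large primes *)

Lemma foldr_ominz_le (s : seq (option int)) (v : int) : Some v \in s ->
  exists2 w, foldr ominz None s = Some w & w <= v.
Proof.
elim: s => [|o s IH] //=; rewrite inE => /predU1P[<-|/IH[w -> wv]].
  by case: foldr => [w|]; [exists (Num.min v w); rewrite //= ge_min lexx|exists v].
by case: o => [u|]; [exists (Num.min u w); rewrite //= ge_min wv orbT|exists w].
Qed.

Lemma common_valuation (N : int) (M : option int) (s : seq (option int)) :
  M = foldr ominz None s -> exists M' : int,
    (forall x : ratfun, vt_opt x \in s -> vt_ge x M') /\
    (forall m : nat, (1 <= m)%N -> m%:Z <= N - M' -> le_N_minus m%:Z N M).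
Proof.
move=> ->; case eM: (foldr ominz None s) => [v|].
  exists v; split=> // x; rewrite /vt_ge; case: vt_opt => // w /foldr_ominz_le[u].
  by rewrite eM => -[<-].
(* Here M is +oo and all the listed valuations are infinite, so any bound holds; the choice [N]
   leaves no m with 1 <= m <= N - M'. *)
exists N; split=> [x|m]; last by lia.
by rewrite /vt_ge; case: vt_opt => // w /foldr_ominz_le[u]; rewrite eM.
Qed.

Lemma flp_impb (b : bool) (Q : nat -> Prop) :
  (b -> for_large_primes Q) -> for_large_primes (fun p => b -> Q p).
Proof. by case: b => [/(_ isT)/flp_imp|_]; [apply=> p _ h _|exists 0%N]. Qed.

Theorem theorem1 (N : int) (n : nat) (f : 'I_n -> {poly int})
    (g0 : ratfun) (g : 'I_n -> ratfun)
    (f_nonconst : forall i, (1 < size (f i))%N)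
    (f_lead_pos : forall i, 0 < lead_coef (f i))
    (M : option int)
    (M_def : M = foldr ominz None (vt_opt g0 :: [seq vt_opt (g i) | i <- enum 'I_n]))
    (cond1 : vt_ge
       (g0 - (1 - tvar^-1) * (\sum_(i | (f i).[1] == 0) g i)
           - \sum_(i | 2 <= (f i).[1])
               (1 - tvar ^+ (`|(f i).[1]|%N.-1)) * ratc (bernz (f i).[1] / (f i).[1]%:~R)
                 * g i * ratfun_of_intpoly (f i)) N)
    (cond2 : forall k : int, (exists i, (f i).[1] = k) -> (2 %| k)%Z -> k <= 0 ->
       forall m : nat, (1 <= m)%N -> le_N_minus m%:Z N M ->
       vt_ge (\sum_(i | (f i).[1] == k) g i * ratfun_of_intpoly (f i) ^+ m) (N + 1 - m%:Z))
    (cond3 : forall k : int, (exists i, (f i).[1] = k) -> (2 %| k)%Z -> 0 < k ->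
       forall m : nat, (2 <= m)%N -> le_N_minus m%:Z N M ->
       vt_ge (\sum_(i | (f i).[1] == k)
                g i * (ratfun_of_intpoly (f i) ^+ m
                       - (k%:~R) ^+ m.-1 * ratfun_of_intpoly (f i))) (N + 1 - m%:Z)) :
  exists P : nat, forall p : nat, prime p -> (P < p)%N ->
    congr_pN p N (\sum_(i < n) feval (g i) p%:Z * bernz (f i).[p%:Z]) (feval g0 p%:Z).
Proof.
have [M' [vg leM]] := common_valuation N M _ M_def.
have {}vg i : vt_ge (g i) M'.
  by apply: vg; rewrite inE; apply/orP; right; apply/map_f; rewrite mem_enum.
(* [L] bounds N - M', so the exponents m range over a finite type and one bound on p serves all
   conditions. *)
pose L := `|N - M'|%N; pose key i := (f i).[1]; pose G i p := feval (g i) p%:Z.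
have eG i : evals (g i) (G i) := evals_feval (g i).
have eF i := evals_intpoly (f i).
have h1 : for_large_primes (fun p => vge p N (feval g0 p%:Z
    - (1 - p%:R^-1) * (\sum_(i | key i == 0) G i p)
    - \sum_(i | 2 <= key i) (1 - p%:R ^+ `|key i|.-1) * (bernz (key i) / (key i)%:~R)
         * G i p * ((f i).[p%:Z])%:~R)).
  apply: flp_vge_evals cond1 _; apply: evalsB.
    apply: evalsB; first exact: evals_feval.
    by apply: evalsM; [apply: evalsB evals1 evals_tvarV|apply: evals_sum].
  apply: evals_sum => i _; apply: evalsM => //; apply: evalsM => //.
  by apply: evalsM; [apply: evalsB evals1 (evalsX _ _ _ evals_tvar)|apply: evals_ratc].
have h2 : for_large_primes (fun p => forall (j : 'I_n) (m : 'I_L.+1),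
    (2 %| key j)%Z -> key j <= 0 -> (1 <= m)%N -> m%:Z <= N - M' ->
    vge p (N + 1 - m%:Z) (\sum_(i | key i == key j) G i p * ((f i).[p%:Z])%:~R ^+ m)).
  apply: flp_forall => j; apply: flp_forall => m.
  do 4!apply: flp_impb => ?; apply: flp_vge_evals.
    by apply: (cond2 (key j)) => //; [exists j|exact: leM].
  by apply: evals_sum => i _; apply: evalsM => //; apply: evalsX.
have h3 : for_large_primes (fun p => forall (j : 'I_n) (m : 'I_L.+1),
    (2 %| key j)%Z -> 0 < key j -> (2 <= m)%N -> m%:Z <= N - M' ->
    vge p (N + 1 - m%:Z) (\sum_(i | key i == key j)
      G i p * (((f i).[p%:Z])%:~R ^+ m - (key j)%:~R ^+ m.-1 * ((f i).[p%:Z])%:~R))).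
  apply: flp_forall => j; apply: flp_forall => m.
  do 4!apply: flp_impb => ?; apply: flp_vge_evals.
    by apply: (cond3 (key j)) => //; [exists j|apply: leM => //; apply: ltnW].
  apply: evals_sum => i _; apply: evalsM => //; apply: evalsB; first exact: evalsX.
  apply: evalsM => //; apply: (evalsX _ (fun=> (key j)%:~R)).
  by have := evals_ratc (key j)%:~R; rewrite /ratc !rmorph_int.
have hG : for_large_primes (fun p => forall i, vge p M' (G i p)).
  by apply: flp_forall => i; apply: flp_vge_feval.
have hF : for_large_primes (fun p => forall i, (L.+2)%:Z <= (f i).[p%:Z]).
  apply: flp_forall => i; have [C hC] := horner_int_growth _ (f_lead_pos i).
  apply: flp_imp (flp_gt (C + L.+2)) _ => p _ lt.
  have [_ /(_ (f_nonconst i))] := hC p ltac:(lia); lia.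
have hk : for_large_primes (fun p => forall i, (2 ^ `|key i| < p)%N).
  by apply: flp_forall => i; apply: flp_gt.
have [P hP] := flp_and _ _ (flp_and _ _ h1 (flp_and _ _ h2 h3))
  (flp_and _ _ (flp_and _ _ hG hF) (flp_and _ _ hk (flp_gt L.+2))).
exists P => p pr /(hP p pr)[[{}h1 [{}h2 {}h3]] [[{}hG {}hF] [{}hk Lp]]].
apply: vge_congr_pN => //.
have ordL (m : nat) : m%:Z <= N - M' -> (m < L.+1)%N by rewrite /L; lia.
apply: (bernoulli_congr_at p L M' N n key (fun i => (f i).[p%:Z]) (G ^~ p)) => //.
- by rewrite /L; lia.
(* This is f_i(p) = f_i(1) modulo p - 1. *)
- move=> i; rewrite (_ : p.-1%:Z = p%:Z - 1); first exact: dvdz_horner_sub.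
  by have := prime_gt0 pr; lia.
- by move=> j ev kj m m1 mN; apply: (h2 j (Ordinal (ordL m mN))).
- by move=> j ev kj m m1 mN; apply: (h3 j (Ordinal (ordL m mN))).
Qed.
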